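(* Let $\mathcal{E}$ and $\mathcal{R}$ be finite sets (entities and relations) and let $m\ge 1$. ComplEx embeddings of embedding size $m$ can be fully recovered by ANALOGY embeddings of embedding size $2m$ with $n=0$. That is, for every choice of ComplEx embeddings $v_e\in\mathbb{C}^m$ ($e\in\mathcal{E}$) and $v_r\in\mathbb{C}^m$ ($r\in\mathcal{R}$), there exist vectors $u_e\in\mathbb{R}^{2m}$ ($e\in\mathcal{E}$) and matrices $B_r\in\mathcal{B}^0_{2m}$ ($r\in\mathcal{R}$) such that for all $s,o\in\mathcal{E}$ and $r\in\mathcal{R}$, $$\Re\big(\langle v_s,v_r,\overline{v_o}\rangle\big)=u_s^\top B_r u_o .$$
   Context: The ComplEx model of embedding size $m$ assigns complex vectors in $\mathbb{C}^m$ to entities and relations, with score $\phi(s,r,o)=\Re(\langle v_s,v_r,\overline{v_o}\rangle)$, where $\langle a,b,c\rangle=\sum_{k=1}^m a_kb_kc_k$ (no conjugation) is the generalized trilinear inner product, $\overline{x}$ is the entrywise complex conjugate, and $\Re$ is the real part. The ANALOGY model of embedding size $2m$ with $n=0$ assigns a vector $u_e\in\mathbb{R}^{2m}$ to each entity $e$ and a matrix $B_r\in\mathcal{B}^0_{2m}$ to each relation $r$, with score $\phi(s,r,o)=u_s^\top B_r u_o$. Here $\mathcal{B}^0_{2m}$ is the set of all $2m\times 2m$ real block-diagonal matrices with $m$ consecutive $2\times2$ diagonal blocks, each of the form $\begin{bmatrix} x & -y\\ y & x\end{bmatrix}$ with $x,y\in\mathbb{R}$ (and no scalar blocks). *)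

(* Defs.v *)
From mathcomp Require Import all_boot all_order all_algebra.
From mathcomp Require Import reals.
From mathcomp Require Import complex.

Set Implicit Arguments.
Unset Strict Implicit.
Unset Printing Implicit Defensive.

Import GRing.Theory.
Local Open Scope ring_scope.

Definition trilinear (K : comNzRingType) (m : nat) (a b c : 'cV[K]_m) : K :=
  \sum_(k < m) a k 0 * b k 0 * c k 0.

Definition complex_score (R : realType) (m : nat) (vs vr vo : 'cV[R[i]]_m) : R :=
  complex.Re (trilinear vs vr (map_mx (@conjc R) vo)).

Definition analogy_score (R : realType) (d : nat)
    (us : 'cV[R]_d) (B : 'M[R]_d) (uo : 'cV[R]_d) : R :=
  (us^T *m B *m uo) 0 0.

Definition analogy_block (R : realType) (x y : R) : 'M[R]_2 :=
  \matrix_(i < 2, j < 2)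
    nth 0 (nth [::] [:: [:: x; - y];
                        [:: y;   x]] i) j.

(* The size of [\mxdiag] is a sum over the blocks; this casts it to [2 * m]. *)
Lemma sum_blocks2 (m : nat) : (\sum_(k < m) 2 = 2 * m)%N.
Proof. by rewrite sum_nat_const card_ord mulnC. Qed.

Definition analogy0_mx (R : realType) (m : nat) (B : 'M[R]_(2 * m)) : Prop :=
  exists x y : 'I_m -> R,
    B = castmx (sum_blocks2 m, sum_blocks2 m)
          (\mxdiag_(k < m) analogy_block (x k) (y k)).

(* Main.v *)
(** Identify [z : R[i]] with the column [(Re z, Im z)].  The dot product of the
    columns of [z] and [w] is [Re (z * conj w)], and
    [s * r * conj o = s * conj (conj r * o)]; so each summand of the ComplEx score
    is the dot product of [s] with [conj r * o], where multiplication by [conj r]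
    is the real-linear map given by a 2x2 ANALOGY block. *)
Require Import Defs.
From mathcomp Require Import all_boot all_order all_algebra.
From mathcomp Require Import reals.
From mathcomp Require Import complex.
From mathcomp Require Import ring.
Import GRing.Theory.
Local Open Scope ring_scope.

Definition complex_col {R : realType} (z : R[i]) : 'cV[R]_2 :=
  \col_(i < 2) (if i == 0 then complex.Re z else complex.Im z).

(** Keeping [d'] a variable lets [e] be eliminated, which is impossible for the concrete sizes of
    [sum_blocks2]. *)
Lemma analogy_score_cast (R : realType) (d d' : nat) (e : d = d')
    (u w : 'cV[R]_d) (B : 'M[R]_d) :
  analogy_score (castmx (e, erefl) u) (castmx (e, e) B) (castmx (e, erefl) w)
  = analogy_score u B w.
Proof. by case: d' / e; rewrite !castmx_id. Qed.

(** Distinct diagonal blocks do not interact; this reduces the theorem to a single complex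
    coordinate. *)
Lemma analogy_score_mxdiag (R : realType) (m : nat) (p : 'I_m -> nat)
    (u w : forall k, 'cV[R]_(p k)) (B : forall k, 'M[R]_(p k)) :
  analogy_score (\mxcol_k u k) (\mxdiag_k B k) (\mxcol_k w k)
  = \sum_k analogy_score (u k) (B k) (w k).
Proof.
by rewrite /analogy_score tr_mxcol mul_mxrow_mxdiag mul_mxrow_mxcol summxE.
Qed.

Lemma analogy_score_block (R : realType) (s r o : R[i]) :
  analogy_score (complex_col s) (analogy_block (complex.Re r) (- complex.Im r))
    (complex_col o)
  = complex.Re (s * r * conjc o).
Proof.
rewrite /analogy_score -mulmxA !mxE !big_ord_recl big_ord0 !mxE.
rewrite !big_ord_recl !big_ord0 !mxE /=.
case: s r o => [a b] [c d] [e f] /=; ring.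
Qed.

Theorem proposition5p2 (R : realType) (E Rel : finType) (m : nat) (hm : (1 <= m)%N)
    (vE : E -> 'cV[R[i]]_m) (vR : Rel -> 'cV[R[i]]_m) :
  exists (u : E -> 'cV[R]_(2 * m)) (B : Rel -> 'M[R]_(2 * m)),
    (forall r : Rel, analogy0_mx (B r)) /\
    (forall (s o : E) (r : Rel),
       complex_score (vE s) (vR r) (vE o) = analogy_score (u s) (B r) (u o)).
Proof.
exists (fun e => castmx (sum_blocks2 m, erefl) (\mxcol_(k < m) complex_col (vE e k 0))).
(* [analogy_block x y] is multiplication by [x + iy], so the minus sign conjugates the relation. *)
exists (fun r => castmx (sum_blocks2 m, sum_blocks2 m)
  (\mxdiag_(k < m) analogy_block (complex.Re (vR r k 0)) (- complex.Im (vR r k 0)))).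
split=> [r | s o r].
  by exists (fun k => complex.Re (vR r k 0)), (fun k => - complex.Im (vR r k 0)).
(* Additivity of [complex.Re] turns the left side into a sum over [k] too, so terms can be
   matched. *)
rewrite analogy_score_cast analogy_score_mxdiag /complex_score /trilinear raddf_sum.
by apply: eq_bigr => k _; rewrite mxE analogy_score_block.
Qed.
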